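(* Let $\mathcal A\subseteq B(\mathcal H)$ be a unital $C^*$-subalgebra and let $T=T^*\in B(\mathcal H)$. Then $T\in\mathcal F(\mathcal A)$ if and only if $T$ is matricially order determined by $\mathcal A$.
   Context: $\mathcal F(\mathcal A)=\{T\in B(\mathcal H):\phi(T)=T$ for every completely contractive map $\phi:B(\mathcal H)\to B(\mathcal H)$ that is the identity on $\mathcal A\}$ (since $\mathcal A$ is unital, such maps are exactly the unital completely positive maps fixing $\mathcal A$). For a self-adjoint operator $X$ on $\mathcal H^{n}$ (i.e. $X\in M_n(B(\mathcal H))$), set $(-\infty,X]_{M_n(\mathcal A)}=\{A=A^*\in M_n(\mathcal A):A\le X\}$ and $[X,+\infty)_{M_n(\mathcal A)}=\{A=A^*\in M_n(\mathcal A):X\le A\}$. For a set $S$ of self-adjoint operators, $S\le Y$ means $A\le Y$ for all $A\in S$, and $Y\le S$ means $Y\le A$ for all $A\in S$. $T=T^*$ is matricially order determined by $\mathcal A$ if, for $R=R^*\in B(\mathcal H)$, the condition that $$(-\infty,T\otimes H]_{M_n(\mathcal A)}\le R\otimes H\le[T\otimes H,+\infty)_{M_n(\mathcal A)}$$ holds for every $n$ and every $H=H^*\in M_n$ (the $n\times n$ complex matrices) implies $R=T$. *)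

(* Defs.v *)
From HB Require Import structures.
From mathcomp Require Import all_boot all_order all_algebra.
From mathcomp Require Import all_classical all_reals all_analysis.
From mathcomp Require Import complex.
Set Implicit Arguments.
Unset Strict Implicit.
Unset Printing Implicit Defensive.
Import Order.TTheory GRing.Theory Num.Theory.
Import numFieldNormedType.Exports.
Local Open Scope classical_set_scope.
Local Open Scope ring_scope.
Local Open Scope complex_scope.

(* [inner] is linear in its first argument and antilinear in its second. *)
HB.mixin Record isHilbert (C : numClosedFieldType) H
    & CompleteNormedModule C H := {
  inner : {dot H for Num.conj};
  sqr_norm_inner : forall x : H, `|x| ^+ 2 = inner x x
}.

#[short(type="hilbertType")]
HB.structure Definition Hilbert (C : numClosedFieldType) :=
  {H of CompleteNormedModule C H & isHilbert C H}.

Section BoundedOp.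
Variables (R : realType) (H : hilbertType R[i]).
Implicit Types (x y : H).

Definition bounded_linear : {pred H -> H} := fun T =>
  `[< linear T /\ exists M : R, forall x, `|T x| <= M%:C * `|x| >].

Record boundedOp := BoundedOp {
  boundedOp_fun :> H -> H;
  boundedOpP : boundedOp_fun \in bounded_linear
}.

HB.instance Definition _ := [isSub for boundedOp_fun].
HB.instance Definition _ := [Choice of boundedOp by <:].

Lemma bounded_linear_submod : GRing.subsemimod_closed bounded_linear.
Proof.
split; [split|].
- apply/asboolP; split.
    by move=> a u v; rewrite -[LHS]/0 -[RHS]/(a *: 0 + 0) scaler0 addr0.
  by exists 0 => x; rewrite normr0 mul0r.
- move=> S T /asboolP[lS [M SM]] /asboolP[lT [N TN]]; apply/asboolP; split.
    move=> a u v; rewrite !addrfctE lS lT scalerDr.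
    by rewrite -!addrA; congr (_ + _); rewrite addrCA.
  exists (M + N) => x; rewrite addrfctE rmorphD mulrDl.
  by rewrite (le_trans (ler_normD _ _))// lerD.
- move=> a T /asboolP[lT [M TM]]; apply/asboolP; split.
    move=> b u v; rewrite !scalrfctE lT scalerDr; congr (_ + _).
    by rewrite !scalerA mulrC.
  exists (complex.Re `|a| * M) => x; rewrite scalrfctE normrZ rmorphM /= -mulrA.
  have -> : (complex.Re `|a|)%:C = `|a| by apply: RRe_real.
  by rewrite ler_wpM2l.
Qed.

HB.instance Definition _ := GRing.isSubmodClosed.Build R[i] (H -> H)
  bounded_linear bounded_linear_submod.
HB.instance Definition _ := [SubChoice_isSubLmodule of boundedOp by <:].

Lemma opDE (S T : boundedOp) x : (S + T) x = S x + T x.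
Proof. by rewrite -[boundedOp_fun (S + T)]/(val (S + T)) raddfD. Qed.

Lemma opZE (a : R[i]) (T : boundedOp) x : (a *: T) x = a *: T x.
Proof. by rewrite -[boundedOp_fun (a *: T)]/(val (a *: T)) linearZ. Qed.

Lemma op_linear (T : boundedOp) : linear T.
Proof. by have /asboolP[] := boundedOpP T. Qed.

HB.instance Definition _ (T : boundedOp) :=
  GRing.isLinear.Build R[i] H H *:%R T (op_linear T).

Definition opnorm (T : boundedOp) : R :=
  sup [set complex.Re `|T x| | x in [set x : H | `|x| <= 1]].

Lemma op_bounded (T : boundedOp) :
  exists2 M : R, 0 <= M & forall x, `|T x| <= M%:C * `|x|.
Proof.
have /asboolP[_ [M TM]] := boundedOpP T; exists (Num.max M 0).
  by rewrite le_max lexx orbT.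
move=> x; rewrite (le_trans (TM x))// ler_wpM2r// lecR.
by rewrite le_max lexx.
Qed.

Let normE x : (complex.Re `|x|)%:C = `|x|.
Proof. exact: RRe_real. Qed.

Let opset_sup (T : boundedOp) :
  has_sup [set complex.Re `|T x| | x in [set x : H | `|x| <= 1]].
Proof.
split; first by exists (complex.Re `|T 0|), 0 => //=; rewrite normr0.
have [M M0 TM] := op_bounded T; exists M => _ [x /= x1 <-].
rewrite -lecR normE (le_trans (TM x))//.
by rewrite -[leRHS]mulr1 ler_wpM2l// ler0c.
Qed.

Lemma opnorm_ge0 T : 0 <= opnorm T.
Proof.
rewrite (@le_trans _ _ (complex.Re `|T 0|))//.
  by rewrite -lecR normE normr_ge0.
by apply: (sup_upper_bound (opset_sup T)); exists 0 => //=; rewrite normr0.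
Qed.

Lemma le_opnorm (T : boundedOp) x : `|T x| <= (opnorm T)%:C * `|x|.
Proof.
have [->|x0] := eqVneq x 0; first by rewrite linear0 !normr0 mulr0.
rewrite -ler_pdivrMr ?normr_gt0//.
have <- : `|T (`|x|^-1 *: x)| = `|T x| / `|x|.
  by rewrite linearZ normrZ normfV normr_id mulrC.
rewrite -normE lecR; apply: (sup_upper_bound (opset_sup T)).
exists (`|x|^-1 *: x) => //=.
by rewrite normrZ normfV normr_id mulVf// normr_eq0.
Qed.

Lemma opnorm_le (T : boundedOp) (M : R) :
  0 <= M -> (forall x, `|T x| <= M%:C * `|x|) -> opnorm T <= M.
Proof.
move=> M0 TM; apply: ge_sup; first by case: (opset_sup T).
move=> _ [x /= x1 <-]; rewrite -lecR normE (le_trans (TM x))//.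
by rewrite -[leRHS]mulr1 ler_wpM2l// ler0c.
Qed.

Let opnormC (T : boundedOp) : R[i] := (opnorm T)%:C.

Let opnormCD S T : opnormC (S + T) <= opnormC S + opnormC T.
Proof.
rewrite -rmorphD lecR opnorm_le ?addr_ge0 ?opnorm_ge0// => x.
by rewrite opDE rmorphD mulrDl (le_trans (ler_normD _ _))// lerD// le_opnorm.
Qed.

Let opnormCZ_le (a : R[i]) T : opnormC (a *: T) <= `|a| * opnormC T.
Proof.
have aE : (complex.Re `|a|)%:C = `|a| by apply: RRe_real.
rewrite -aE -rmorphM lecR opnorm_le//.
  by rewrite mulr_ge0 ?opnorm_ge0// -lecR aE normr_ge0.
by move=> x; rewrite opZE normrZ rmorphM -[X in X * _ * _]/((complex.Re `|a|)%:C) aE -mulrA ler_wpM2l// le_opnorm.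
Qed.

Let opnormCZ (a : R[i]) T : opnormC (a *: T) = `|a| * opnormC T.
Proof.
apply/eqP; rewrite eq_le opnormCZ_le/=.
have [->|a0] := eqVneq a 0; first by rewrite normr0 mul0r ler0c opnorm_ge0.
rewrite -ler_pdivlMl ?normr_gt0// -normfV.
by rewrite -[in leLHS](scale1r T) -(mulVf a0) -scalerA opnormCZ_le.
Qed.

Let opnormC_eq0 T : opnormC T = 0 -> T = 0.
Proof.
move=> T0; apply/val_inj/funext => x; apply/eqP.
rewrite -[val 0 x]/0 -normr_eq0 eq_le normr_ge0 andbT.
by rewrite (le_trans (le_opnorm T x))// -/(opnormC T) T0 mul0r.
Qed.

HB.instance Definition _ := Lmodule_isNormed.Build R[i] boundedOp
  opnormCD opnormCZ opnormC_eq0.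

Lemma normr_opE (T : boundedOp) : `|T| = (opnorm T)%:C.
Proof. by []. Qed.

Lemma op1_subproof : (id : H -> H) \in bounded_linear.
Proof.
apply/asboolP; split; first by move=> a u v.
by exists 1 => x; rewrite mul1r.
Qed.
Definition op1 : boundedOp := BoundedOp op1_subproof.

Lemma opcomp_subproof (S T : boundedOp) :
  ((S : H -> H) \o (T : H -> H)) \in bounded_linear.
Proof.
apply/asboolP; split; first by move=> a u v; rewrite /= !linearP.
have [M M0 SM] := op_bounded S; have [N N0 TN] := op_bounded T.
exists (M * N) => x /=; rewrite (le_trans (SM _))// rmorphM -mulrA.
by rewrite ler_wpM2l// ler0c.
Qed.
Definition opcomp (S T : boundedOp) : boundedOp :=
  BoundedOp (opcomp_subproof S T).

(* [is_adjoint T S] says that S = T^*. It is a relation, so that the Riesz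
   representation theorem is not needed to write it down. *)
Definition is_adjoint (T S : boundedOp) :=
  forall x y, inner (T x) y = inner x (S y).
Definition selfadjoint (T : boundedOp) := is_adjoint T T.

Definition unital_cstar_subalgebra (A : set boundedOp) :=
  [/\ A op1,
      forall (a : R[i]) S T, A S -> A T -> A (a *: S + T),
      forall S T, A S -> A T -> A (opcomp S T),
      forall T, A T -> exists2 S, A S & is_adjoint T S
    & closed A].

(* A matrix over B(H) acts on H^n, which carries the l^2 inner product. *)
Definition inner_vec n (u v : 'I_n -> H) : R[i] :=
  \sum_i inner (u i) (v i).
Definition mx_app n (X : 'M[boundedOp]_n) (u : 'I_n -> H) : 'I_n -> H :=
  fun i => \sum_j X i j (u j).

Definition mx_opnorm n (X : 'M[boundedOp]_n) : R :=
  sup [set Num.sqrt (complex.Re (inner_vec (mx_app X u) (mx_app X u)))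
      | u in [set u | inner_vec u u <= 1]].

Definition mx_selfadjoint n (X : 'M[boundedOp]_n) :=
  forall u v, inner_vec (mx_app X u) v = inner_vec u (mx_app X v).

(* In R[i], a <= b means that b - a is real and nonnegative. *)
Definition mx_ople n (X Y : 'M[boundedOp]_n) :=
  forall u, inner_vec (mx_app X u) u <= inner_vec (mx_app Y u) u.

Definition completely_contractive (phi : boundedOp -> boundedOp) :=
  forall n (X : 'M[boundedOp]_n), mx_opnorm (map_mx phi X) <= mx_opnorm X.

(* The set F(A). *)
Definition fixed_hull (A : set boundedOp) : set boundedOp :=
  [set T | forall phi : {linear boundedOp -> boundedOp},
     completely_contractive phi -> (forall S, A S -> phi S = S) ->
     phi T = T].

Definition mx_sa_over (A : set boundedOp) n : set 'M[boundedOp]_n :=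
  [set X | mx_selfadjoint X /\ forall i j, A (X i j)].

(* (-oo, X] and [X, +oo) in M_n(A). *)
Definition mx_below (A : set boundedOp) n (X : 'M[boundedOp]_n) :=
  [set Y | mx_sa_over A Y /\ mx_ople Y X].
Definition mx_above (A : set boundedOp) n (X : 'M[boundedOp]_n) :=
  [set Y | mx_sa_over A Y /\ mx_ople X Y].

(* T (x) h as an element of M_n(B(H)), under the identification of H (x) C^n
   with H^n *)
Definition tens_mx (T : boundedOp) n (h : 'M[R[i]]_n) : 'M[boundedOp]_n :=
  \matrix_(i, j) (h i j *: T).

Definition matricially_order_determined (A : set boundedOp) (T : boundedOp) :=
  forall S, selfadjoint S ->
    (forall n (h : 'M[R[i]]_n), h \is hermsymmx ->
       (forall X, mx_below A (tens_mx T h) X -> mx_ople X (tens_mx S h)) /\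
       (forall X, mx_above A (tens_mx T h) X -> mx_ople (tens_mx S h) X)) ->
    S = T.

End BoundedOp.

Notation "''B' ( H )" := (boundedOp H) (format "''B' ( H )") : type_scope.

(* Main.v *)
Require Import Defs.
From HB Require Import structures.
From mathcomp Require Import all_boot all_order all_algebra.
From mathcomp Require Import all_classical all_reals all_analysis.
From mathcomp Require Import complex.
From mathcomp Require Import lra ring.

(** Let [phi] be completely contractive and the identity on [A].  As [A]
contains the unit, [phi] is unital, and a unital complete contraction maps a
matrix of operators with nonnegative real part to one with nonnegative real
part ([cc_accretive]): the matrix [X] has nonnegative real part when the norm of
[X - c] grows at most like [c + O(1/c)] for large [c], and this is preserved.
So [phi] preserves the order at every matrix level ([cc_ople]), and an
inequality between [T (x) h] and a matrix over [A] is carried to the same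
inequality for [phi T (x) h].  If [A] determines [T] matricially, then
[phi T = T].

Conversely, let [S] satisfy the order conditions for [T].  They say that the
assignment [a + l T |-> a + l S] on [A + C T] is completely positive: a positive
matrix over [A + C T] is [a + T (x) h], its hermitian part can be taken over [A]
as [A] is closed under adjoints, and then [- a <= T (x) h] implies
[- a <= S (x) h] ([affine_graph_pos]).  By the Arveson extension theorem the
assignment extends to a completely contractive [phi] on all of B(H).  It fixes
[A] and sends [T] to [S], so [T] in the fixed hull forces [S = T].

Arveson's theorem ([arveson_extension]) is obtained from a single Hahn-Banach
extension, without compactness of the space of maps.  A linear map [phi] on B(H)
amounts to the form [(X, u, v) |-> Re <phi X u, v>], that is, to a functional on
the real span of the tensors [X (x) u (x) v], conjugate linear in [v].  Such a
tensor is realised as the function [g |-> Re <X (g u), g v>] of an operator [g].  The cone of pointwise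
nonnegative functions then encodes complete positivity: if the vectors are
expanded in an orthonormal family [e], the values [g (e i)] are arbitrary, so a
function that is nonnegative at every [g] comes from a matrix of operators with
nonnegative real part.  Evaluation at [g = 1] after replacing [X] by its
prescribed image is a positive functional on the tensors with [X] in the domain.
The unit belongs to this domain, which makes every tensor dominated there, and
the functional extends ([krein_extension], from [hahn_banach]).  The Riesz
theorem ([riesz_representation]) turns the extended functional into operators,
and positivity on [c (|g u|^2 + |g v|^2) + 2 Re <X (g u), g v>] bounds the norm
of the extended map at each matrix level. *)

Set Implicit Arguments.
Unset Strict Implicit.
Unset Printing Implicit Defensive.
Import Order.TTheory GRing.Theory Num.Theory.
Import numFieldNormedType.Exports.
Local Open Scope classical_set_scope.
Local Open Scope ring_scope.
Local Open Scope complex_scope.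

(** * Positive extension of functionals *)

(** Functionals are total functions on [E] and the subspace is a set [D]: in
the application [D] is the part of a function space on which the dominating
functional is a finite infimum. *)
Section HahnBanach.
Variables (R : realType) (E : lmodType R) (D : set E).
Hypotheses (D0 : D 0) (DD : forall x y, D x -> D y -> D (x + y))
  (DZ : forall t x, D x -> D (t *: x)).

Let DN x : D x -> D (- x).
Proof. by rewrite -scaleN1r; exact: DZ. Qed.

Definition sublinear_on (q : E -> R) :=
  (forall x y, D x -> D y -> q (x + y) <= q x + q y) /\
  (forall t x, 0 < t -> D x -> q (t *: x) <= t * q x).

Definition linear_on (q : E -> R) :=
  (forall x y, D x -> D y -> q (x + y) = q x + q y) /\
  (forall t x, D x -> q (t *: x) = t * q x).

Lemma sublinear_on0 q : sublinear_on q -> q 0 = 0.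
Proof.
move=> [_ qZ].
have h2 : 0 < 2^-1 :> R by rewrite invr_gt0.
have := qZ _ _ (ltr0Sn R 1) D0; have := qZ _ _ h2 D0.
by rewrite !scaler0; lra.
Qed.

Lemma sublinear_on_ge q x : sublinear_on q -> D x -> - q (- x) <= q x.
Proof.
move=> hq Dx; have := hq.1 x (- x) Dx (DN Dx).
by rewrite subrr sublinear_on0//; lra.
Qed.

Lemma sublinear_onZ q t x : sublinear_on q -> 0 <= t -> D x ->
  q (t *: x) = t * q x.
Proof.
move=> hq; rewrite le_eqVlt => /predU1P[<- _|t0 Dx].
  by rewrite scale0r mul0r sublinear_on0.
apply/eqP; rewrite eq_le hq.2//= -ler_pdivlMl//.
rewrite -[in leLHS](scale1r x) -(mulVf (lt0r_neq0 t0)) -scalerA.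
by apply: hq.2 (DZ _ Dx); rewrite invr_gt0.
Qed.

Lemma le_inf_mem (S : set R) (m x : R) :
  (forall y, S y -> m <= y) -> S x -> inf S <= x.
Proof. by move=> Sm Sx; apply: ge_inf => //; exists m. Qed.

(** A minimal sublinear functional [q] is linear.  For a direction [x], the
functional [y |-> inf_t (q (y + t x) - t q x)] over [t >= 0] is sublinear and
below [q], hence equal to [q]; its bound at [t = 1] is superadditivity of
[q]. *)
Section minimal.
Variable q : E -> R.
Hypotheses (hq : sublinear_on q)
  (qmin : forall q', sublinear_on q' -> (forall x, D x -> q' x <= q x) ->
     forall x, D x -> q x <= q' x).

Section direction.
Variables (x : E) (Dx : D x).

Let S y := [set q (y + t *: x) - t * q x | t in [set t : R | 0 <= t]].
Let q' y := inf (S y).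

Let lbS y z : D y -> S y z -> - q (- y) <= z.
Proof.
move=> Dy [t /= t0 <-].
have := hq.1 (y + t *: x) (- y) ltac:(by apply: DD => //; exact: DZ) (DN Dy).
by rewrite addrAC subrr add0r sublinear_onZ//; lra.
Qed.

Let q'_le y t : D y -> 0 <= t -> q' y <= q (y + t *: x) - t * q x.
Proof. by move=> Dy t0; apply: (le_inf_mem (fun z => @lbS y z Dy)); exists t. Qed.

Let le_q' y m : (forall t, 0 <= t -> m <= q (y + t *: x) - t * q x) ->
  m <= q' y.
Proof.
move=> h; apply: lb_le_inf; first by exists (q (y + 0 *: x) - 0 * q x), 0 => /=.
by move=> _ [t /= t0 <-]; exact: h.
Qed.

Let q'_sub : sublinear_on q'.
Proof.
split=> [y z Dy Dz|t y t0 Dy].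
  rewrite -lerBlDr; apply: le_q' => s s0; rewrite lerBlDr -lerBlDl.
  apply: le_q' => t t0; rewrite lerBlDl.
  apply: (le_trans (q'_le (t := s + t) (DD Dy Dz) (addr_ge0 s0 t0))).
  have := hq.1 (y + s *: x) (z + t *: x) (DD Dy (DZ _ Dx)) (DD Dz (DZ _ Dx)).
  by rewrite scalerDl addrACA; lra.
rewrite -ler_pdivrMl//; apply: le_q' => s s0.
rewrite ler_pdivrMl//.
apply: (le_trans (q'_le (t := t * s) (DZ _ Dy) (mulr_ge0 (ltW t0) s0))).
rewrite -scalerA -scalerDr (sublinear_onZ hq (ltW t0) (DD Dy (DZ _ Dx))).
by rewrite mulrBr mulrA.
Qed.

Lemma minimal_superadd y : D y -> q y + q x <= q (y + x).
Proof.
move=> Dy.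
have /(_ y Dy)/le_trans : forall x, D x -> q x <= q' x.
  apply: qmin q'_sub _ => z Dz; apply: (le_trans (q'_le Dz (lexx 0))).
  by rewrite scale0r addr0 mul0r subr0.
by move=> /(_ _ (q'_le Dy ler01)); rewrite scale1r mul1r; lra.
Qed.

End direction.

Lemma minimal_linear_on : linear_on q.
Proof.
have qD x y : D x -> D y -> q (x + y) = q x + q y.
  by move=> Dx Dy; apply/eqP; rewrite eq_le hq.1//= minimal_superadd.
split=> // t x Dx; have [t0|/ltW t0] := leP 0 t; first exact: sublinear_onZ.
have := qD (t *: x) (- t *: x) (DZ _ Dx) (DZ _ Dx).
rewrite -scalerDl subrr scale0r sublinear_on0// (sublinear_onZ (t := - t))//.
  lra.
by rewrite oppr_ge0.
Qed.

End minimal.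

(** Zorn's lemma gives a minimal sublinear functional below [p]: along a chain,
the pointwise infimum is sublinear, and it is finite because every member [q]
satisfies [q x >= - q (- x) >= - p (- x)]. *)
Theorem hahn_banach p : sublinear_on p ->
  exists2 f, linear_on f & forall x, D x -> f x <= p x.
Proof.
move=> hp.
pose Q := {q : E -> R | sublinear_on q /\ forall x, D x -> q x <= p x}.
pose le (q q' : Q) := `[< forall x, D x -> sval q' x <= sval q x >].
have [||A Atot|q qmin] := @ZL_preorder Q (exist _ p (conj hp (fun x _ => lexx (p x)))) le.
- by move=> q; apply/asboolP.
- move=> q1 q2 q3 /asboolP h /asboolP h'; apply/asboolP => x Dx.
  exact: le_trans (h' _ Dx) (h _ Dx).
- have [[q0 Aq0]|A0] := pselect (exists q, A q); last first.
    exists (exist _ p (conj hp (fun x _ => lexx (p x)))) => q Aq.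
    by case: A0; exists q.
  pose S x := [set sval q x | q in A]; pose m x := inf (S x).
  have m_le x q : D x -> A q -> m x <= sval q x.
    move=> Dx Aq; apply: (@le_inf_mem _ (- p (- x))); last by exists q.
    move=> _ [[q' /= [hq' q'p]] _ <-]; apply: le_trans (sublinear_on_ge hq' Dx).
    by rewrite lerN2; exact/q'p/DN.
  have le_m x c : (forall q, A q -> c <= sval q x) -> c <= m x.
    move=> h; apply: lb_le_inf; first by exists (sval q0 x), q0.
    by move=> _ [q Aq <-]; exact: h.
  have msub : sublinear_on m.
    split=> [x y Dx Dy|t x t0 Dx]; last first.
      rewrite -ler_pdivrMl//; apply: (le_m _ _) => q Aq; rewrite ler_pdivrMl//.
      by rewrite (le_trans (m_le _ _ (DZ _ Dx) Aq))// (svalP q).1.2.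
    rewrite -lerBlDr; apply: (le_m _ _) => q Aq; rewrite lerBlDr -lerBlDl.
    apply: (le_m _ _) => q' Aq'; rewrite lerBlDl.
    have [/asboolP h|/asboolP h] := Atot _ _ Aq Aq'.
      apply: (le_trans (m_le _ _ (DD Dx Dy) Aq')).
      by apply: (le_trans ((svalP q').1.1 _ _ Dx Dy)); rewrite lerD// h.
    apply: (le_trans (m_le _ _ (DD Dx Dy) Aq)).
    by apply: (le_trans ((svalP q).1.1 _ _ Dx Dy)); rewrite lerD// h.
  have mp x : D x -> m x <= p x.
    by move=> Dx; apply: le_trans (m_le _ _ Dx Aq0) _; exact: (svalP q0).2.
  by exists (exist _ m (conj msub mp)) => q Aq; apply/asboolP => x Dx; exact: m_le.
- exists (sval q); last exact: (svalP q).2.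
  apply: minimal_linear_on (svalP q).1 _ => q' hq' q'q x Dx.
  have q'p y : D y -> q' y <= p y.
    by move=> Dy; apply: le_trans (q'q _ Dy) _; exact: (svalP q).2.
  have /asboolP := qmin (exist _ q' (conj hq' q'p)) ltac:(by apply/asboolP).
  exact.
Qed.

End HahnBanach.

(** A functional on a subspace is given by its graph [W].  As [P] contains
[0], positivity of [W] along [P] forces equal arguments to have equal values, so
that no quotient or choice of representatives is involved. *)
Section Krein.
Variables (R : realType) (E : lmodType R) (P : set E) (W : set (E * R)).
Hypotheses (P0 : P 0) (PD : forall x y, P x -> P y -> P (x + y))
  (PZ : forall t x, 0 <= t -> P x -> P (t *: x)).
Hypotheses (W0 : W 0) (WD : forall a b, W a -> W b -> W (a + b))
  (WZ : forall t a, W a -> W (t *: a.1, t * a.2))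
  (W_ge0 : forall w, W w -> P w.1 -> 0 <= w.2).

(** The elements that lie, for the order of the cone, between two elements of
the domain of [W]; this is where the infimum defining the dominating functional
is finite. *)
Definition dominated : set E := [set v |
  (exists2 w, W w & P (w.1 - v)) /\ (exists2 w, W w & P (w.1 + v))].

Lemma dominatedD u v : dominated u -> dominated v -> dominated (u + v).
Proof.
move=> [[a Wa Pa] [b Wb Pb]] [[c Wc Pc] [d Wd Pd]]; split.
  exists (a + c); first exact: WD.
  by rewrite opprD addrACA; exact: PD.
by exists (b + d); [exact: WD | rewrite addrACA; exact: PD].
Qed.

Lemma dominatedZ t v : dominated v -> dominated (t *: v).
Proof.
move=> [[a Wa Pa] [b Wb Pb]].
have [t0|/ltW t0] := leP 0 t.
  split; [exists (t *: a.1, t * a.2) | exists (t *: b.1, t * b.2)] => /=;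
    try exact: WZ.
  - by rewrite -scalerBr; exact: PZ.
  - by rewrite -scalerDr; exact: PZ.
split; [exists (- t *: b.1, - t * b.2) | exists (- t *: a.1, - t * a.2)] => /=;
    try exact: WZ.
- rewrite -scaleNr -scalerDr; apply: PZ => //; by rewrite oppr_ge0.
- rewrite -[t *: v]opprK -scaleNr -scalerBr; apply: PZ => //; by rewrite oppr_ge0.
Qed.

Lemma dominatedW w : W w -> dominated w.1.
Proof.
move=> Ww; split; first by exists w => //; rewrite subrr.
by exists (-1 *: w.1, -1 * w.2) => /=; [exact: WZ|rewrite scaleN1r addNr].
Qed.

(** The least value of [W] above [v] is sublinear in [v].  A linear [f] below
it is nonpositive on the opposite of the cone, since [0] is above there, and it
is bounded by the value on [W] and on its opposite, hence agrees with it. *)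
Theorem krein_extension : exists f : E -> R,
  [/\ linear_on dominated f, forall v, dominated v -> P v -> 0 <= f v
    & forall w, W w -> f w.1 = w.2].
Proof.
pose S v := [set w.2 | w in [set w | W w /\ P (w.1 - v)]].
pose p v := inf (S v).
have p_le v w : dominated v -> W w -> P (w.1 - v) -> p v <= w.2.
  move=> [_ [b Wb Pb]] Ww Pw; apply: (@le_inf_mem _ _ (- b.2)); last by exists w.
  move=> _ [a [Wa Pa] <-]; rewrite lerNl -subr_ge0 opprK addrC.
  apply: (W_ge0 (WD Wa Wb)) => /=.
  by rewrite -(subrKA v) [v + _]addrC; exact: PD.
have le_p v c : dominated v -> (forall w, W w -> P (w.1 - v) -> c <= w.2) -> c <= p v.
  move=> [[a Wa Pa] _] h; apply: lb_le_inf; first by exists a.2, a.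
  by move=> _ [w [Ww Pw] <-]; exact: h.
have [|f lf fp] := @hahn_banach R E dominated (dominatedW W0) dominatedD dominatedZ p.
  split=> [x y Dx Dy|t x t0 Dx].
    rewrite -lerBlDr; apply: (le_p _ _) => // a Wa Pa; rewrite lerBlDr -lerBlDl.
    apply: (le_p _ _) => // b Wb Pb; rewrite lerBlDl.
    apply: (p_le _ (a + b)) (dominatedD Dx Dy) (WD Wa Wb) _.
    by rewrite /= opprD addrACA; exact: PD.
  rewrite -ler_pdivrMl//; apply: (le_p _ _) => // a Wa Pa; rewrite ler_pdivrMl//.
  apply: (p_le _ (t *: a.1, t * a.2)) (dominatedZ _ Dx) (WZ _ Wa) _ => /=.
  by rewrite -scalerBr; apply: PZ => //; exact: ltW.
have fN v : dominated v -> f (- v) = - f v.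
  by move=> Dv; rewrite -scaleN1r lf.2// mulN1r.
have f_le w : W w -> f w.1 <= w.2.
  move=> Ww; apply: le_trans (fp _ (dominatedW Ww)) _.
  by apply: p_le (dominatedW Ww) Ww _; rewrite subrr.
exists f; split=> // [v Dv Pv|w Ww].
  have DNv : dominated (- v) by rewrite -scaleN1r; exact: dominatedZ.
  rewrite -oppr_le0 -fN//; apply: le_trans (fp _ DNv) _.
  by apply: (p_le _ 0) => //=; rewrite opprK add0r.
apply/eqP; rewrite eq_le f_le//=.
have /= := f_le _ (WZ (-1) Ww).
by rewrite lf.2 ?mulN1r ?lerN2//; exact: dominatedW.
Qed.

End Krein.

(** * The real inner product *)

(** Norms and positivity involve only the real part of the inner product.  Its
properties as a real bilinear form are isolated here so that vectors and finite
families of vectors are covered together. *)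
Section RealForm.
Variables (R : realType) (V : lmodType R[i]) (b : V -> V -> R).
Hypotheses (bDl : forall x y z, b (x + y) z = b x z + b y z)
  (bZl : forall (t : R) x y, b (t%:C *: x) y = t * b x y)
  (bC : forall x y, b x y = b y x) (b_ge0 : forall x, 0 <= b x x).

Lemma formDr x y z : b x (y + z) = b x y + b x z.
Proof. by rewrite bC bDl !(bC x). Qed.

Lemma formZr (t : R) x y : b x (t%:C *: y) = t * b x y.
Proof. by rewrite bC bZl bC. Qed.

Lemma form_expand (t : R) x y :
  b (x + t%:C *: y) (x + t%:C *: y) = b x x + t * (2 * b x y) + t ^+ 2 * b y y.
Proof. by rewrite !(bDl, formDr, bZl, formZr) (bC y x); ring. Qed.

(** The expression is [|w + c v|^2 / c] plus the slack of the hypothesis on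
[w] divided by [c].  Together with [form_young_inv], this trades a norm bound
for a family of positivity statements that are linear in [w]. *)
Lemma form_young (c s : R) w v : 0 < c -> b w w <= c ^+ 2 * s ->
  0 <= c * (s + b v v) + 2 * b w v.
Proof.
move=> c0 ws; have := b_ge0 (w + c%:C *: v); rewrite form_expand => h.
rewrite -(pmulr_rge0 _ c0); nra.
Qed.

(** Taking [v = - w / c], the minimiser of the expression, recovers the
bound. *)
Lemma form_young_inv (c s : R) w : 0 < c ->
  (forall v, 0 <= c * (s + b v v) + 2 * b w v) -> b w w <= c ^+ 2 * s.
Proof.
move=> c0 /(_ ((- c^-1)%:C *: w)); rewrite bZl !formZr => h.
have : 0 <= c * (c * (s + - c^-1 * (- c^-1 * b w w)) + 2 * (- c^-1 * b w w)).
  by rewrite mulr_ge0// ltW.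
rewrite [X in 0 <= X -> _](_ : _ = c ^+ 2 * s - b w w); last by field; lra.
by rewrite subr_ge0.
Qed.

End RealForm.

Section Hilbert.
Variables (R : realType) (H : hilbertType R[i]).
Implicit Types (x y z : H) (a : R[i]) (t : R).

Definition rdot x y : R := complex.Re (inner x y).

Lemma ReD a c : complex.Re (a + c) = complex.Re a + complex.Re c.
Proof. by case: a c => ? ? []. Qed.

Lemma innerC x y : inner x y = (inner y x)^*.
Proof. by rewrite hermC expr0 mul1r. Qed.

Lemma innerDl x y z : inner (x + y) z = inner x z + inner y z.
Proof. exact: linearDl. Qed.
Lemma inner_suml I (r : seq I) (F : I -> H) y :
  inner (\sum_(i <- r) F i) y = \sum_(i <- r) inner (F i) y.
Proof. exact: linear_sumlz. Qed.
Lemma inner_sumr I (r : seq I) (F : I -> H) y :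
  inner y (\sum_(i <- r) F i) = \sum_(i <- r) inner y (F i).
Proof. exact: linear_sumr. Qed.
Lemma innerZl a x y : inner (a *: x) y = a * inner x y.
Proof. exact: linearZl_LR. Qed.
Lemma innerDr x y z : inner z (x + y) = inner z x + inner z y.
Proof. exact: linearD. Qed.
Lemma innerZr a x y : inner x (a *: y) = a^* * inner x y.
Proof. exact: linearZ. Qed.

Lemma rdotDl x y z : rdot (x + y) z = rdot x z + rdot y z.
Proof. by rewrite /rdot innerDl ReD. Qed.
Lemma rdotC x y : rdot x y = rdot y x.
Proof. by rewrite /rdot innerC; case: (inner y x). Qed.
Lemma rdotZl t x y : rdot (t%:C *: x) y = t * rdot x y.
Proof. by rewrite /rdot innerZl; case: (inner x y) => p q /=; rewrite mul0r subr0. Qed.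
Lemma rdotZ a x y : rdot (a *: x) y = rdot x (a^* *: y).
Proof. by rewrite /rdot innerZl innerZr conjCK. Qed.
Lemma rdotxxE x : (rdot x x)%:C = `|x| ^+ 2.
Proof.
rewrite sqr_norm_inner /rdot RRe_real// -sqr_norm_inner.
by rewrite ger0_real// exprn_ge0.
Qed.
Lemma rdot_ge0 x : 0 <= rdot x x.
Proof. by rewrite -lecR rdotxxE exprn_ge0. Qed.

End Hilbert.

(** * The Riesz representation theorem *)

Section Riesz.
Variables (R : realType) (H : hilbertType R[i]).
Implicit Types (x y z v w : H).

Lemma rdot_expand (t : R) x y : rdot (x + t%:C *: y) (x + t%:C *: y) =
  rdot x x + t * (2 * rdot x y) + t ^+ 2 * rdot y y.
Proof. exact: form_expand (@rdotDl R H) (@rdotZl R H) (@rdotC R H) _ _ _. Qed.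

Lemma norm_lt_rdot (d : R) x : 0 < d -> rdot x x < d ^+ 2 -> `|x| < d%:C.
Proof.
move=> d0 xd; rewrite -(@ltr_pXn2r _ 2)// ?nnegrE ?normr_ge0//; last first.
  by rewrite lecR ltW.
by rewrite -rdotxxE -rmorphXn ltcR.
Qed.

Lemma rdot_lt_norm (d : R) x : `|x| < d%:C -> rdot x x < d ^+ 2.
Proof.
move=> xd; rewrite -ltcR rdotxxE rmorphXn.
by rewrite ltrXn2r// nnegrE normr_ge0.
Qed.

(** The hypothesis [L_le] is boundedness of [L] put in the form in which it is
used: [J v = |v|^2 - 2 L v] is bounded below.  A minimising sequence of [J] is
Cauchy by the parallelogram law, and its limit represents [L] because almost
minimisers almost satisfy the Euler equation [Re <v, w> = L w]. *)
Section represent.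
Variables (L : H -> R) (M : R).
Hypotheses (LD : forall x y, L (x + y) = L x + L y)
  (LZ : forall (t : R) x, L (t%:C *: x) = t * L x)
  (L_le : forall x, 2 * L x <= rdot x x + M).

Let J v := rdot v v - 2 * L v.
Let m := inf (range J).

Let m_le v : m <= J v.
Proof.
apply: (@le_inf_mem _ _ (- M)); last by exists v.
by move=> _ [u _ <-]; rewrite /J; have := L_le u; lra.
Qed.

Let J_adh (e : R) : 0 < e -> exists v, J v < m + e.
Proof.
move=> e0; have [|_ [v _ <-] h] := @inf_adherent _ (range J) e e0; last by exists v.
split; first by exists (J 0), 0.
by exists (- M) => _ [u _ <-]; rewrite /J; have := L_le u; lra.
Qed.

Let J_expand (t : R) x y : J (x + t%:C *: y) =
  J x + t * (2 * (rdot x y - L y)) + t ^+ 2 * rdot y y.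
Proof. by rewrite /J rdot_expand LD LZ; ring. Qed.

Let J_close (e : R) x y : J x < m + e -> J y < m + e -> rdot (x - y) (x - y) < 4 * e.
Proof.
(* The parallelogram law: J is at least m at the midpoint of x and y. *)
move=> xe ye; have := m_le (x + (- 2^-1)%:C *: (x - y)).
rewrite J_expand.
have : J y = J (x + (-1)%:C *: (x - y)).
  by rewrite rmorphN1 scaleN1r opprB addrC subrK.
rewrite J_expand; lra.
Qed.

(** Compare [J] at [v] with its values at [v + d w] and [v - d w]. *)
Let J_var (d : R) w v : 0 < d -> J v < m + d ^+ 2 ->
  `|rdot v w - L w| <= d * (1 + rdot w w) / 2.
Proof.
move=> d0 vd.
have := m_le (v + d%:C *: w); have := m_le (v + (- d)%:C *: w).
rewrite !J_expand => h1 h2; rewrite ler_norml.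
apply/andP; split; rewrite -(ler_pM2l d0); nra.
Qed.

Lemma riesz_representation : exists x, forall v, rdot x v = L v.
Proof.
have /choice[u uP] n : exists v, J v < m + n.+1%:R^-1 by apply: J_adh; rewrite invr_gt0.
have u_near (d : R) : 0 < d -> \forall n \near \oo, J (u n) < m + d.
  move=> d0; near=> n; apply: lt_trans (uP n) _; rewrite ltrD2l.
  by near: n; exact: near_infty_natSinv_lt (PosNum d0).
have cu : cauchy (u @ \oo).
  apply/cauchy_ballP => e e0.
  have [d d0 ->] : exists2 d : R, 0 < d & e = d%:C.
    by exists (complex.Re e); [case: e e0 => p q; rewrite ltcE /= => /andP[]|rewrite RRe_real// gtr0_real].
  have d4 : 0 < d ^+ 2 / 4 by rewrite divr_gt0// exprn_gt0.
  exists ([set v | J v < m + d ^+ 2 / 4] , [set v | J v < m + d ^+ 2 / 4]).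
    by split; exact: u_near.
  move=> [y z] [/= hy hz]; rewrite -ball_normE /=; apply: norm_lt_rdot => //.
  by apply: (lt_le_trans (J_close hy hz)); rewrite mulrC divfK.
have [x ux] : exists x, u @ \oo --> x by apply/cvg_ex/cauchy_cvgP.
exists x => w; apply/eqP; rewrite -subr_eq0 -normr_le0; apply/ler_addgt0Pr => e e0.
pose d := e / (1 + rdot w w).
have w0 : 0 < 1 + rdot w w by rewrite ltr_pwDl// rdot_ge0.
have d0 : 0 < d by rewrite divr_gt0.
have [v [vd vx]] : exists v, J v < m + d ^+ 2 /\ rdot (x - v) (x - v) < d ^+ 2.
  have dC0 : 0 < d%:C by rewrite ltcR.
  have d20 : 0 < d ^+ 2 by rewrite exprn_gt0.
  have [n [? ?]] : exists n, J (u n) < m + d ^+ 2 /\ `|x - u n| < d%:C.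
    near \oo => n; exists n; split; near: n; first exact: u_near.
    exact: cvgr_dist_lt ux _ dC0.
  by exists (u n); split=> //; exact: rdot_lt_norm.
have := J_var w d0 vd.
have : `|rdot (x - v) w| <= d * (1 + rdot w w) / 2.
  have := rdot_ge0 ((x - v) + d%:C *: w); have := rdot_ge0 ((x - v) + (- d)%:C *: w).
  rewrite !rdot_expand => h1 h2; rewrite ler_norml.
  by apply/andP; split; rewrite -(ler_pM2l d0); nra.
have -> : rdot x w - L w = rdot (x - v) w + (rdot v w - L w).
  by rewrite addrA -rdotDl subrK.
have -> : d * (1 + rdot w w) / 2 = e / 2 by rewrite /d divfK// gt_eqF.
by move=> h1 h2; apply: le_trans (ler_normD _ _) _; lra.
Unshelve. all: by end_near.
Qed.

End represent.
End Riesz.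

(** * Vectors and matrices of operators *)

(** Reality of [z] as a condition on a real part, like its sign: both can be
transported by a map that preserves nonnegative real parts. *)
Lemma complex_ge0P (R : realType) (z : R[i]) :
  reflect (0 <= complex.Re z /\ complex.Re ('i * z) = 0) (0 <= z).
Proof.
case: z => p q; rewrite lecE /= mul0r mul1r add0r.
apply: (iffP andP) => -[]; first by move=> /eqP -> ?; rewrite oppr0.
by move=> ? /eqP; rewrite oppr_eq0.
Qed.

Section Vectors.
Variables (R : realType) (H : hilbertType R[i]) (n : nat).
Implicit Types (u v w : 'I_n -> H) (X Y : 'M['B(H)]_n).

Definition rvec u v : R := complex.Re (inner_vec u v).

Lemma rvecE u v : rvec u v = \sum_i rdot (u i) (v i).
Proof.
rewrite /rvec /inner_vec; apply: (big_morph (@complex.Re R)) => //.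
exact: ReD.
Qed.

Lemma rvecDl u v w : rvec (u + v) w = rvec u w + rvec v w.
Proof. by rewrite !rvecE -big_split; apply: eq_bigr => i _; exact: rdotDl. Qed.

Lemma rvecZl (t : R) u v : rvec (t%:C *: u) v = t * rvec u v.
Proof. by rewrite !rvecE big_distrr; apply: eq_bigr => i _; exact: rdotZl. Qed.

Lemma rvecC u v : rvec u v = rvec v u.
Proof. by rewrite !rvecE; apply: eq_bigr => i _; exact: rdotC. Qed.

Lemma rvecZr (t : R) u v : rvec u (t%:C *: v) = t * rvec u v.
Proof. by rewrite rvecC rvecZl rvecC. Qed.

Lemma rvec_ge0 u : 0 <= rvec u u.
Proof. by rewrite rvecE sumr_ge0// => i _; exact: rdot_ge0. Qed.

Lemma rdot_le_rvec u i : rdot (u i) (u i) <= rvec u u.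
Proof.
rewrite rvecE (bigD1 i)//= lerDl sumr_ge0// => j _; exact: rdot_ge0.
Qed.

Lemma inner_vecC u v : inner_vec u v = (inner_vec v u)^*.
Proof. by rewrite rmorph_sum; apply: eq_bigr => i _; rewrite innerC. Qed.

Lemma inner_vecZl a u v : inner_vec (a *: u) v = a * inner_vec u v.
Proof. by rewrite /inner_vec big_distrr; apply: eq_bigr => i _; exact: innerZl. Qed.

Lemma inner_vecBl u v w : inner_vec (u - v) w = inner_vec u w - inner_vec v w.
Proof. by rewrite /inner_vec -sumrB; apply: eq_bigr => i _; exact: linearBl. Qed.

Lemma inner_vecxxE u : inner_vec u u = (rvec u u)%:C.
Proof.
rewrite rvecE rmorph_sum; apply: eq_bigr => i _.
by rewrite -sqr_norm_inner -rdotxxE.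
Qed.

Lemma mx_app_linearZ X a u : mx_app X (a *: u) = a *: mx_app X u.
Proof.
apply/funext => i; rewrite /mx_app !fctE scaler_sumr.
by apply: eq_bigr => j _; rewrite linearZ.
Qed.

Lemma mx_appD X Y u : mx_app (X + Y) u = mx_app X u + mx_app Y u.
Proof.
apply/funext => i; rewrite /mx_app !fctE -big_split.
by apply: eq_bigr => j _; rewrite mxE opDE.
Qed.

Lemma mx_appZ a X u : mx_app (map_mx ( *:%R a) X) u = a *: mx_app X u.
Proof.
apply/funext => i; rewrite /mx_app !fctE scaler_sumr.
by apply: eq_bigr => j _; rewrite mxE opZE.
Qed.

Lemma mx_appB X Y u : mx_app (X - Y) u = mx_app X u - mx_app Y u.
Proof.
apply/funext => i; rewrite /mx_app !fctE -sumrN -big_split.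
by apply: eq_bigr => j _; rewrite !mxE opDE -scaleN1r opZE scaleN1r.
Qed.

Lemma mx_opleP X Y : mx_ople X Y <->
  forall u, 0 <= rvec (mx_app (Y - X) u) u /\
            rvec ('i *: mx_app (Y - X) u) u = 0.
Proof.
split=> h u; first have := h u.
  rewrite -subr_ge0 -inner_vecBl -mx_appB => /complex_ge0P.
  by rewrite /rvec inner_vecZl.
have := h u; rewrite /rvec inner_vecZl => /complex_ge0P.
by rewrite mx_appB inner_vecBl subr_ge0.
Qed.

Lemma rdot_op_le (T : 'B(H)) x :
  rdot (T x) (T x) <= opnorm T ^+ 2 * rdot x x.
Proof.
have : `|T x| ^+ 2 <= ((opnorm T)%:C * `|x|) ^+ 2.
  rewrite lerXn2r ?nnegrE ?normr_ge0 ?le_opnorm//.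
  by rewrite mulr_ge0// ler0c opnorm_ge0.
by rewrite exprMn -!rdotxxE -rmorphXn -rmorphM lecR.
Qed.

Lemma mx_app_bounded X : exists M, forall u, rvec u u <= 1 ->
  rvec (mx_app X u) (mx_app X u) <= M.
Proof.
exists (\sum_i (\sum_j opnorm (X i j)) ^+ 2) => u u1.
rewrite rvecE; apply: ler_sum => i _.
rewrite -lecR rdotxxE [leRHS]rmorphXn lerXn2r ?nnegrE ?normr_ge0//.
  by rewrite ler0c sumr_ge0// => j _; exact: opnorm_ge0.
rewrite /= rmorph_sum (le_trans (ler_norm_sum _ _ _))//; apply: ler_sum => j _.
rewrite (le_trans (le_opnorm _ _))// ler_piMr ?ler0c ?opnorm_ge0//.
rewrite -(@ler_pXn2r _ 2)// ?nnegrE// expr1n -rdotxxE lecR.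
exact: le_trans (rdot_le_rvec u j) u1.
Qed.

Lemma mx_opnorm_has_sup X :
  has_sup [set Num.sqrt (complex.Re (inner_vec (mx_app X u) (mx_app X u)))
    | u in [set u | inner_vec u u <= 1]].
Proof.
split.
  exists (Num.sqrt (rvec (mx_app X 0) (mx_app X 0))), 0 => //=.
  by rewrite /inner_vec big1 ?ler01// => i _; exact: linear0l.
have [M XM] := mx_app_bounded X; exists (Num.sqrt M) => _ [u /= u1 <-].
by rewrite ler_wsqrtr// XM// -lecR -inner_vecxxE.
Qed.

Lemma mx_opnorm_ge0 X : 0 <= mx_opnorm X.
Proof.
have [[r Sr] _] := mx_opnorm_has_sup X.
apply: le_trans (sup_upper_bound (mx_opnorm_has_sup X) Sr).
by case: Sr => u _ <-; exact: sqrtr_ge0.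
Qed.

Lemma mx_opnorm_le X (K : R) : 0 <= K ->
  (forall u, rvec (mx_app X u) (mx_app X u) <= K ^+ 2 * rvec u u) ->
  mx_opnorm X <= K.
Proof.
move=> K0 XK; apply: ge_sup (mx_opnorm_has_sup X).1 _.
move=> _ [u /= u1 <-]; rewrite -(ger0_norm K0) -sqrtr_sqr ler_sqrt ?exprn_ge0//.
rewrite (le_trans (XK u))// ler_piMr ?exprn_ge0//.
by rewrite -lecR -inner_vecxxE.
Qed.

Lemma rvec_mx_app_le X u :
  rvec (mx_app X u) (mx_app X u) <= mx_opnorm X ^+ 2 * rvec u u.
Proof.
have unit v : rvec v v <= 1 -> rvec (mx_app X v) (mx_app X v) <= mx_opnorm X ^+ 2.
  move=> v1; rewrite -[leLHS]sqr_sqrtr ?rvec_ge0// lerXn2r ?nnegrE ?sqrtr_ge0//.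
    exact: mx_opnorm_ge0.
  by apply: (sup_upper_bound (mx_opnorm_has_sup X)); exists v => //=; rewrite inner_vecxxE lecR.
have [u0|u_neq0] := eqVneq (rvec u u) 0.
  have u00 i : u i = 0.
    apply/eqP; rewrite -normr_eq0 -sqrf_eq0 -rdotxxE.
    have := rdot_le_rvec u i; rewrite u0 => /(conj (rdot_ge0 (u i)))/andP.
    by rewrite -eq_le => /eqP <-.
  have -> : mx_app X u = u.
    by apply/funext => i; rewrite u00 /mx_app big1// => j _; rewrite u00 linear0.
  by rewrite u0 mulr0.
have u_gt0 : 0 < rvec u u by rewrite lt_neqAle eq_sym u_neq0 rvec_ge0.
pose t := (Num.sqrt (rvec u u))^-1.
have t2 : t * t = (rvec u u)^-1 by rewrite -expr2 exprVn sqr_sqrtr// ltW.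
have := unit (t%:C *: u).
rewrite mx_app_linearZ !(rvecZl, rvecZr) !mulrA t2 mulVf// => /(_ (lexx _)).
by rewrite mulrC ler_pdivrMr.
Qed.


End Vectors.

(** * Completely contractive unital maps *)

Section CompletelyContractive.
Variables (R : realType) (H : hilbertType R[i]).
Variable phi : {linear 'B(H) -> 'B(H)}.
Hypotheses (phi_cc : completely_contractive phi) (phi1 : phi (op1 H) = op1 H).

Lemma map_tens_mx (T : 'B(H)) n (h : 'M[R[i]]_n) :
  map_mx phi (tens_mx T h) = tens_mx (phi T) h.
Proof. by apply/matrixP => i j; rewrite !mxE linearZ. Qed.

(** For [c > 0] the norm of [X - c] is at most the square root of
[|X|^2 + c^2], because the cross term [- 2 c Re <X u, u>] is nonpositive.  The
same bound holds for [phi X - c]; expanding its square gives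
[2 c Re <phi X u, u> + |X|^2 |u|^2 >= 0], and [c] is arbitrary. *)
Lemma cc_accretive n (X : 'M['B(H)]_n) :
  (forall u, 0 <= rvec (mx_app X u) u) ->
  forall u, 0 <= rvec (mx_app (map_mx phi X) u) u.
Proof.
move=> Xacc u; set r := rvec _ u.
suff key c : 0 < c -> 0 <= 2 * c * r + mx_opnorm X ^+ 2 * rvec u u.
  rewrite leNgt; apply/negP => r0.
  have s0 : 0 <= mx_opnorm X ^+ 2 * rvec u u.
    by rewrite mulr_ge0 ?rvec_ge0// exprn_ge0// mx_opnorm_ge0.
  (* This c makes the left side of key equal to -1. *)
  have := key ((mx_opnorm X ^+ 2 * rvec u u + 1) / (- 2 * r)).
  rewrite divr_gt0 ?ltr_wpDl//; last by nra.
  move=> /(_ isT); rewrite [X in X + _](_ : _ = - (mx_opnorm X ^+ 2 * rvec u u + 1)).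
    by lra.
  by field; lra.
move=> c0; pose Y := X + tens_mx (op1 H) ((- c)%:C%:M).
have app1 (v : 'I_n -> H) : mx_app (tens_mx (op1 H) ((- c)%:C%:M)) v = (- c)%:C *: v.
  apply/funext => i; rewrite /mx_app (bigD1 i)//= big1 => [|j ji].
    by rewrite !mxE eqxx opZE addr0.
  by rewrite !mxE eq_sym (negbTE ji) opZE scale0r.
have expand (Z : 'M['B(H)]_n) v : rvec (mx_app Z v + (- c)%:C *: v) (mx_app Z v + (- c)%:C *: v) =
    rvec (mx_app Z v) (mx_app Z v) - 2 * c * rvec (mx_app Z v) v + c ^+ 2 * rvec v v.
  rewrite (form_expand (@rvecDl R H n) (@rvecZl R H n) (@rvecC R H n)).
  by ring.
have Kc0 : 0 <= mx_opnorm X ^+ 2 + c ^+ 2 by rewrite addr_ge0// sqr_ge0.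
have Y_le : mx_opnorm Y <= Num.sqrt (mx_opnorm X ^+ 2 + c ^+ 2).
  apply: mx_opnorm_le; first exact: sqrtr_ge0.
  move=> v; rewrite sqr_sqrtr// mx_appD app1 expand.
  have := rvec_mx_app_le X v; have := Xacc v; nra.
have := rvec_mx_app_le (map_mx phi Y) u.
rewrite map_mxD map_tens_mx phi1 mx_appD app1 expand -/r.
have := le_trans (phi_cc Y) Y_le.
rewrite -(@ler_pXn2r _ 2)// ?nnegrE ?sqrtr_ge0 ?mx_opnorm_ge0// sqr_sqrtr//.
have := rvec_ge0 u; have := rvec_ge0 (mx_app (map_mx phi X) u).
rewrite map_mxD map_tens_mx phi1.
nra.
Qed.

Lemma map_mx_scale n a (X : 'M['B(H)]_n) :
  map_mx phi (map_mx ( *:%R a) X) = map_mx ( *:%R a) (map_mx phi X).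
Proof. by apply/matrixP => i j; rewrite !mxE linearZ. Qed.

(** Real quadratic forms are those for which both [i X] and [- i X] have
nonnegative real part. *)
Lemma cc_real n (X : 'M['B(H)]_n) :
  (forall u, rvec ('i *: mx_app X u) u = 0) ->
  forall u, rvec ('i *: mx_app (map_mx phi X) u) u = 0.
Proof.
move=> Xr u; apply/eqP; rewrite eq_le; apply/andP; split.
  have : forall u, 0 <= rvec (mx_app (map_mx ( *:%R (- 'i)) X) u) u.
    by move=> v; rewrite mx_appZ -[- 'i]mulN1r -scalerA -(rmorphN1 (real_complex R)) rvecZl Xr mulr0.
  move=> /cc_accretive/(_ u); rewrite map_mx_scale mx_appZ -[- 'i]mulN1r -scalerA.
  by rewrite -(rmorphN1 (real_complex R)) rvecZl mulN1r oppr_ge0.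
have : forall u, 0 <= rvec (mx_app (map_mx ( *:%R 'i) X) u) u.
  by move=> v; rewrite mx_appZ Xr.
by move=> /cc_accretive/(_ u); rewrite map_mx_scale mx_appZ.
Qed.

Lemma cc_ople n (X Y : 'M['B(H)]_n) :
  mx_ople X Y -> mx_ople (map_mx phi X) (map_mx phi Y).
Proof.
move=> /mx_opleP XY; apply/mx_opleP => u; rewrite -map_mxB; split.
  by apply: cc_accretive => v; exact: (XY v).1.
by apply: cc_real => v; exact: (XY v).2.
Qed.

End CompletelyContractive.

Section SelfAdjoint.
Variables (R : realType) (H : hilbertType R[i]).

Lemma inner_eq (x y x' y' : H) : (forall a : R[i], rdot (a *: x) y = rdot (a *: x') y') ->
  inner x y = inner x' y'.
Proof.
move=> h; apply/eqP; rewrite eq_complex -/(rdot x y) -/(rdot x' y').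
have := h 1; rewrite !scale1r => ->; rewrite eqxx /=; have := h 'i.
rewrite /rdot !innerZl; case: (inner x y) (inner x' y') => [p q] [p' q'] /=.
by rewrite !mul0r !mul1r !sub0r => /oppr_inj ->.
Qed.

(** Polarization of the quadratic form. *)
Lemma selfadjointP (T : 'B(H)) :
  selfadjoint T <-> forall x, rdot ('i *: T x) x = 0.
Proof.
split=> [sT x|Tr].
  have : inner (T x) x = (inner (T x) x)^* by rewrite {1}sT innerC.
  rewrite /rdot innerZl; case: (inner _ _) => p q [/eqP] /=.
  by rewrite mul0r mul1r sub0r; lra.
have polar x y : rdot ('i *: T x) y = - rdot ('i *: T y) x.
  have := Tr (x + y); rewrite linearD scalerDr !rdotDl !(rdotC _ (x + y)) !rdotDl.
  by rewrite !(rdotC _ ('i *: _)) !Tr; lra.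
have sym x y : rdot (T x) y = rdot x (T y).
  have := polar (- 'i *: x) y; rewrite linearZ scalerA mulrN -expr2 sqr_i opprK scale1r => ->.
  rewrite rdotZ scalerA.
  have -> : ('i : R[i])^* * - 'i = -1.
    by apply/eqP; rewrite eq_complex /=; apply/andP; split; apply/eqP; ring.
  by rewrite rdotC -(rmorphN1 (real_complex R)) rdotZl mulN1r opprK.
by move=> x y; apply: inner_eq => a; rewrite -linearZ sym.
Qed.

End SelfAdjoint.

Section Backward.
Variables (R : realType) (H : hilbertType R[i]) (A : set 'B(H)) (T : 'B(H)).
Hypotheses (A1 : A (op1 H)) (hT : selfadjoint T).

Lemma determined_fixed : matricially_order_determined A T -> fixed_hull A T.
Proof.
move=> det phi phi_cc phiA; have phi1 := phiA _ A1.
have fixX n (X : 'M['B(H)]_n) : mx_sa_over A X -> map_mx phi X = X.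
  by move=> [_ XA]; apply/matrixP => i j; rewrite mxE phiA.
apply: det.
  apply/selfadjointP => x.
  have E (S : 'B(H)) u : rvec ('i *: mx_app (tens_mx S (1%:M : 'M[R[i]]_1)) u) u = rdot ('i *: S (u 0)) (u 0).
    by rewrite rvecE big_ord1 fctE /mx_app big_ord1 mxE mxE eqxx scale1r.
  have := @cc_real R H phi phi_cc phi1 1 (tens_mx T 1%:M) _ (fun=> x).
  rewrite map_tens_mx E; apply=> u; rewrite E.
  by have /selfadjointP -> := hT.
move=> n h hh; split=> X [XA XT]; rewrite -(fixX _ _ XA) -map_tens_mx;
  exact: cc_ople.
Qed.

End Backward.

(** * Orthonormal families and adjoints of matrices *)

Section Orthonormal.
Variables (R : realType) (H : hilbertType R[i]).

(** The family is allowed to be shorter than the list, which may be linearly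
dependent. *)
Lemma gram_schmidt (us : seq H) : exists n (e : 'I_n -> H),
  (forall i j, inner (e i) (e j) = (i == j)%:R) /\
  {in us, forall u, u = \sum_i inner u (e i) *: e i}.
Proof.
elim: us => [|u us [n [e [eo eP]]]].
  by exists 0, (fun=> 0); split=> // -[].
pose p := \sum_i inner u (e i) *: e i; pose r := u - p.
have re i : inner r (e i) = 0.
  rewrite innerDl -scaleN1r innerZl mulN1r inner_suml (bigD1 i)//= big1 => [|j ji].
    by rewrite innerZl eo eqxx mulr1 addr0 subrr.
  by rewrite innerZl eo (negbTE ji) mulr0.
have [r0|r0] := eqVneq r 0.
  exists n, e; split=> // v; rewrite inE => /predU1P[->|]; last exact: eP.
  by apply/eqP; rewrite -subr_eq0 -/p -/r r0.
have er i : inner (e i) r = 0 by rewrite innerC re rmorph0.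
have nr0 : `|r| != 0 by rewrite normr_eq0.
have nrJ x y : inner x (`|r|^-1 *: y) = `|r|^-1 * inner x y.
  rewrite innerZr; congr (_ * _); apply: geC0_conj; by rewrite invr_ge0.
pose e' (i : 'I_n.+1) := if unlift ord0 i is Some j then e j else `|r|^-1 *: r.
have e'0 : e' ord0 = `|r|^-1 *: r by rewrite /e' unlift_none.
have e'S i : e' (lift ord0 i) = e i by rewrite /e' liftK.
exists n.+1, e'; split=> [i j|v].
  case: (unliftP ord0 i) => [i'|] ->; case: (unliftP ord0 j) => [j'|] ->;
    rewrite ?e'0 ?e'S ?innerZl ?nrJ ?er ?re ?mulr0 //.
  by rewrite -sqr_norm_inner expr2 mulKf// mulVf// eqxx.
rewrite inE big_ord_recl e'0 nrJ scalerA.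
under eq_bigr do rewrite e'S.
move=> /predU1P[->|vus].
  have -> : inner u r = `|r| ^+ 2.
    rewrite -[u](subrK p) -/r innerDl -sqr_norm_inner inner_suml big1 ?addr0//.
    by move=> i _; rewrite innerZl er mulr0.
  by rewrite expr2 mulKf// mulfV// scale1r /r subrK.
have -> : inner v r = 0.
  by rewrite (eP v vus) inner_suml big1// => i _; rewrite innerZl er mulr0.
by rewrite mulr0 mul0r scale0r add0r; exact: eP.
Qed.

Lemma norm_inner_unit (x y : H) : inner y y = 1 -> `|inner x y| <= `|x|.
Proof.
move=> y1; rewrite -(@ler_pXn2r _ 2)// ?nnegrE//.
have := exprn_ge0 2 (normr_ge0 (x - inner x y *: y)).
rewrite !sqr_norm_inner -scaleNr !(innerDl, innerDr) !(innerZl, innerZr) y1 (innerC y x).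
by rewrite rmorphN !mulNr mulr1 mulrN opprK addNr addr0 normCK mulrC subr_ge0.
Qed.

Lemma finite_rank_op n (e y : 'I_n -> H) :
    (forall i, inner (e i) (e i) = 1) ->
  exists g : 'B(H), forall x, g x = \sum_i inner x (e i) *: y i.
Proof.
move=> e1; suff gP : (fun x => \sum_i inner x (e i) *: y i) \in @bounded_linear R H.
  by exists (BoundedOp gP).
apply/asboolP; split=> [a u v|].
  rewrite scaler_sumr -big_split; apply: eq_bigr => i _.
  by rewrite innerDl innerZl scalerDl scalerA.
exists (complex.Re (\sum_i `|y i|)) => x.
rewrite RRe_real; last by rewrite ger0_real// sumr_ge0.
rewrite (le_trans (ler_norm_sum _ _ _))// big_distrl; apply: ler_sum => i _.
by rewrite /= normrZ mulrC ler_wpM2l// norm_inner_unit.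
Qed.

End Orthonormal.

Section MatrixAdjoint.
Variables (R : realType) (H : hilbertType R[i]) (n : nat).
Implicit Types (X Y : 'M['B(H)]_n).

Definition mx_is_adjoint X Y := forall i j, is_adjoint (X i j) (Y j i).

Lemma is_adjoint_sym (S S' : 'B(H)) : is_adjoint S S' -> is_adjoint S' S.
Proof. by move=> h x y; rewrite innerC -h -innerC. Qed.

Lemma mx_is_adjointE X Y u v : mx_is_adjoint X Y ->
  inner_vec (mx_app X u) v = inner_vec u (mx_app Y v).
Proof.
move=> Xa; rewrite /inner_vec /mx_app.
under eq_bigr do rewrite inner_suml.
under [RHS]eq_bigr do rewrite inner_sumr.
rewrite exchange_big; apply: eq_bigr => i _; apply: eq_bigr => j _.
exact: Xa.
Qed.

Definition mx_average X Y : 'M['B(H)]_n :=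
  \matrix_(i, j) ((2^-1 : R)%:C *: (X i j + Y i j)).

Lemma mx_is_adjointN X Y : mx_is_adjoint X Y -> mx_is_adjoint (- X) (- Y).
Proof.
move=> XY i j x y; rewrite !mxE.
have opN (S : 'B(H)) z : (- S) z = - 1 *: S z by rewrite -opZE scaleN1r.
rewrite !opN innerZl innerZr XY; congr (_ * _).
exact/esym/(rmorphN1 (@Num.conj R[i])).
Qed.

(** With [Y] the adjoint of [X], the average is the real part of [X]. *)
Lemma mx_average_adjoint X Y : mx_is_adjoint X Y ->
  mx_is_adjoint (mx_average X Y) (mx_average X Y).
Proof.
move=> XY i j x y.
rewrite !mxE !opZE !opDE innerZl innerZr !(innerDl, innerDr) XY.
rewrite -(is_adjoint_sym (XY j i)) addrC; congr (_ * _).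
by apply/esym/geC0_conj; rewrite ler0c invr_ge0.
Qed.

Lemma rvec_mx_average X Y u : mx_is_adjoint X Y ->
  rvec (mx_app (mx_average X Y) u) u = rvec (mx_app X u) u.
Proof.
move=> XY.
have -> : mx_app (mx_average X Y) u = (2^-1 : R)%:C *: (mx_app X u + mx_app Y u).
  apply/funext => i; rewrite /mx_app !fctE -big_split scaler_sumr.
  by apply: eq_bigr => j _; rewrite mxE opZE opDE.
rewrite rvecZl rvecDl [X in _ + X]rvecC /rvec -(mx_is_adjointE _ _ XY).
by field.
Qed.

Lemma mx_selfadjoint_ople X Y : mx_selfadjoint (Y - X) ->
  (forall u, 0 <= rvec (mx_app (Y - X) u) u) -> mx_ople X Y.
Proof.
move=> s h; apply/mx_opleP => u; split=> //.
have : inner_vec (mx_app (Y - X) u) u = (inner_vec (mx_app (Y - X) u) u)^*.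
  by rewrite {1}s inner_vecC.
rewrite /rvec inner_vecZl; case: (inner_vec _ _) => p q [/eqP] /=.
by rewrite mul0r mul1r sub0r; lra.
Qed.

End MatrixAdjoint.

(** * The Arveson extension theorem *)

Lemma rdot_inj (R : realType) (H : hilbertType R[i]) (x y : H) :
  (forall v, rdot x v = rdot y v) -> x = y.
Proof.
move=> xy; apply/eqP; rewrite -subr_eq0 -normr_eq0 -sqrf_eq0 -rdotxxE.
by rewrite -scaleN1r -(rmorphN1 (real_complex R)) rdotDl rdotZl xy; apply/eqP; rewrite mulN1r addrN.
Qed.

Lemma le_norm_rdot (R : realType) (H : hilbertType R[i]) (M : R) (x y : H) :
  0 <= M -> rdot y y <= M ^+ 2 * rdot x x -> `|y| <= M%:C * `|x|.
Proof.
move=> M0 yx; rewrite -(@ler_pXn2r _ 2)// ?nnegrE ?mulr_ge0 ?ler0c//.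
by rewrite exprMn -!rdotxxE -rmorphXn -rmorphM lecR.
Qed.

Lemma rdot_op_leS (R : realType) (H : hilbertType R[i]) (X : 'B(H)) x :
  rdot (X x) (X x) <= (opnorm X + 1) ^+ 2 * rdot x x.
Proof.
apply: le_trans (rdot_op_le X x) _; have X0 := opnorm_ge0 X.
by rewrite ler_wpM2r ?rdot_ge0// lerXn2r ?nnegrE ?addr_ge0// lerDl.
Qed.

Lemma rvec_const_mx_le (R : realType) (H : hilbertType R[i]) (X : 'B(H))
    (w : 'I_1 -> H) :
  rvec (mx_app (const_mx X) w) (mx_app (const_mx X) w)
    <= (opnorm X + 1) ^+ 2 * rvec w w.
Proof. by rewrite !rvecE !big_ord1 /mx_app big_ord1 mxE; exact: rdot_op_leS. Qed.

(** The map to extend is a relation [G], closed under linear combinations, and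
[G_pos] is its complete positivity, in a form that speaks of real parts
because [G] carries no adjoint.  Complete positivity makes [G] single-valued. *)
Section Arveson.
Variables (R : realType) (H : hilbertType R[i]) (G : set ('B(H) * 'B(H))).
Hypotheses (G1 : G (op1 H, op1 H))
  (GP : forall (a : R[i]) p q, G p -> G q -> G (a *: p.1 + q.1, a *: p.2 + q.2))
  (G_pos : forall n (X Y : 'M['B(H)]_n), (forall i j, G (X i j, Y i j)) ->
     (forall u, 0 <= rvec (mx_app X u) u) -> forall u, 0 <= rvec (mx_app Y u) u).

Let G0 : G 0.
Proof. by have := GP (-1) G1 G1; rewrite scaleN1r addNr. Qed.

Let GZ a p : G p -> G (a *: p.1, a *: p.2).
Proof. by move=> Gp; have := GP a Gp G0; rewrite !addr0. Qed.

Let G_sum (I : eqType) (r : seq I) (X Y : I -> 'B(H)) :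
  {in r, forall i, G (X i, Y i)} ->
  G (\sum_(i <- r) X i, \sum_(i <- r) Y i).
Proof.
elim: r => [|i r IH] XY; first by rewrite !big_nil.
have /(GP 1 (XY i (mem_head _ _))) : G (\sum_(i <- r) X i, \sum_(i <- r) Y i).
  by apply: IH => j jr; apply: XY; rewrite inE jr orbT.
by rewrite !big_cons /= !scale1r.
Qed.

(** A term [((X, Y), (u, v))] stands for the tensor of [X], [u] and [v], with
[Y] the prescribed image of [X]. *)
Let term := ('B(H) * 'B(H) * (H * H))%type.
Let tensor (X : 'B(H)) (u v : H) : 'B(H) -> R^o := fun g => rdot (X (g u)) (g v).
Let source (s : seq term) : 'B(H) -> R^o :=
  fun g => \sum_(k <- s) tensor k.1.1 k.2.1 k.2.2 g.
Let value (s : seq term) : R := \sum_(k <- s) rdot (k.1.2 k.2.1) k.2.2.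

Let inner_compress n (e y : 'I_n -> H) (g : 'B(H)) (X : 'B(H)) (u v : H) :
  g u = \sum_j inner u (e j) *: y j -> g v = \sum_i inner v (e i) *: y i ->
  inner (X (g u)) (g v) =
  \sum_i \sum_j inner (((inner v (e i))^* * inner u (e j)) *: X (y j)) (y i).
Proof.
move=> -> ->; rewrite inner_sumr; apply: eq_bigr => i _.
rewrite linear_sum innerZr inner_suml mulr_sumr; apply: eq_bigr => j _.
by rewrite linearZ !innerZl mulrA.
Qed.

(** This is where the concrete model of tensors pays off.  With [e] orthonormal
spanning all vectors of [s], the number [source s g] is the form of one matrix
over the domain of [G] at the family [g (e i)], which can be any family, and
[value s] is the form of the image matrix at [e] itself. *)
Let value_ge0 (s : seq term) : {in s, forall k, G k.1} -> (forall g, 0 <= source s g) ->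
  0 <= value s.
Proof.
move=> sG spos.
have [n [e [eo eP]]] := gram_schmidt ([seq k.2.1 | k <- s] ++ [seq k.2.2 | k <- s]).
pose c (k : term) i j := (inner k.2.2 (e i))^* * inner k.2.1 (e j).
pose M (p : term -> 'B(H)) : 'M['B(H)]_n :=
  \matrix_(i, j) \sum_(k <- s) c k i j *: p k.
have compress (p : term -> 'B(H)) (g : 'B(H)) y : (forall x, g x = \sum_i inner x (e i) *: y i) \/
    (g = op1 H /\ y = e) ->
  \sum_(k <- s) rdot (p k (g k.2.1)) (g k.2.2) = rvec (mx_app (M p) y) y.
  move=> gy; rewrite /rdot /rvec -(big_morph _ (@ReD R) (erefl 0 : complex.Re 0 = 0)).
  congr (complex.Re _); rewrite /inner_vec /mx_app.
  have -> : \sum_(k <- s) inner (p k (g k.2.1)) (g k.2.2) =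
    \sum_(k <- s) \sum_i \sum_j inner (c k i j *: p k (y j)) (y i).
    apply: eq_big_seq => k ks; apply: inner_compress.
      case: gy => [-> //|[-> ->]]; apply: eP.
      by rewrite mem_cat (map_f (fun k : term => k.2.1)).
    case: gy => [-> //|[-> ->]]; apply: eP.
    by rewrite mem_cat (map_f (fun k : term => k.2.2)) ?orbT.
  rewrite exchange_big; apply: eq_bigr => i _.
  rewrite exchange_big inner_suml; apply: eq_bigr => j _.
  rewrite -inner_suml mxE; congr (inner _ (y i)).
  by elim: (s) => [|k s' IH]; rewrite ?big_nil// !big_cons opDE opZE IH.
have -> : value s = rvec (mx_app (M (fun k => k.1.2)) e) e.
  by rewrite -(compress _ (op1 H)); last by right.
apply: (G_pos (X := M (fun k => k.1.1))) => [i j|u].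
  rewrite !mxE; apply: G_sum => k ks; exact: GZ (sG k ks).
have [g gP] := finite_rank_op u (fun i => etrans (eo i i) ltac:(by rewrite eqxx)).
by rewrite -(compress _ g); [exact: spos | left].
Qed.


Let W : set (('B(H) -> R^o) * R) := [set w | exists s : seq term,
  {in s, forall k, G k.1} /\ w = (source s, value s)].

Let Wcone : set ('B(H) -> R^o) := [set w | forall g, 0 <= w g].

Let D := dominated Wcone W.

Let W0 : W 0.
Proof.
exists [::]; split=> //; congr pair; last by rewrite /value big_nil.
by apply/funext => g; rewrite /source big_nil.
Qed.

Let WD a b : W a -> W b -> W (a + b).
Proof.
move=> [s [sG ->]] [t [tG ->]]; exists (s ++ t); split.
  by move=> k; rewrite mem_cat => /orP[/sG|/tG].
congr pair; last by rewrite /value big_cat.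
by apply/funext => g; rewrite /source big_cat.
Qed.

Let WZ (t : R) a : W a -> W (t *: a.1, t * a.2).
Proof.
move=> [s [sG ->]] /=.
exists [seq ((t%:C *: k.1.1, t%:C *: k.1.2), k.2) | k : term <- s]; split.
  by move=> _ /mapP[k ks ->] /=; apply: GZ (sG k ks).
congr pair; last first.
  rewrite /value big_map big_distrr; apply: eq_bigr => k _.
  by rewrite -[RHS]/(rdot ((t%:C *: k.1.2) k.2.1) k.2.2) opZE rdotZl.
apply/funext => g; rewrite /source big_map fctE scaler_sumr.
apply: eq_bigr => k _; rewrite /tensor.
by rewrite -[RHS]/(rdot ((t%:C *: k.1.1) (g k.2.1)) (g k.2.2)) opZE rdotZl.
Qed.

Let W_ge0 w : W w -> Wcone w.1 -> 0 <= w.2.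
Proof. by move=> [s [sG ->]]; exact: value_ge0. Qed.

Let Wcone0 : Wcone 0. Proof. by []. Qed.
Let WconeD x y : Wcone x -> Wcone y -> Wcone (x + y).
Proof. by move=> hx hy g; rewrite addr_ge0. Qed.
Let WconeZ (t : R) x : 0 <= t -> Wcone x -> Wcone (t *: x).
Proof. by move=> t0 hx g; rewrite mulr_ge0. Qed.

Let W_tensor p u v : G p -> W (tensor p.1 u v, rdot (p.2 u) v).
Proof.
move=> Gp; exists [:: (p, (u, v))]; split; first by move=> k; rewrite inE => /eqP ->.
congr pair; last by rewrite /value big_seq1.
by apply/funext => g; rewrite /source big_seq1.
Qed.

(** Domination by a multiple of the tensors of the unit, whose values are
[|g u|^2] and [|g v|^2].  The constant is [opnorm X + 1] because it must be
positive. *)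
Let D_tensor X u v : D (tensor X u v).
Proof.
pose c := opnorm X + 1.
have c0 : 0 < c by rewrite ltr_wpDl// opnorm_ge0.
have young (g : 'B(H)) w : 0 <= c * (rdot (g u) (g u) + rdot w w) + 2 * rdot (X (g u)) w.
  apply: (form_young (@rdotDl R H) (@rdotZl R H) (@rdotC R H) (@rdot_ge0 R H)) => //.
  exact: rdot_op_leS.
have WW : W (c / 2 *: (tensor (op1 H) u u + tensor (op1 H) v v),
    c / 2 * (rdot u u + rdot v v)).
  exact: WZ (WD (W_tensor u u G1) (W_tensor v v G1)).
have wE g : (c / 2 *: (tensor (op1 H) u u + tensor (op1 H) v v)) g =
   c / 2 * (rdot (g u) (g u) + rdot (g v) (g v)) by [].
split; eexists; try exact: WW.
  move=> g; rewrite -[_ g]/((c / 2 *: (tensor (op1 H) u u + tensor (op1 H) v v)) g - tensor X u v g) wE /tensor.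
  have := young g ((-1)%:C *: g v).
  by rewrite rdotZl !(rdotC _ (_ *: _)) !rdotZl (rdotC (g v)); lra.
move=> g; rewrite -[_ g]/((c / 2 *: (tensor (op1 H) u u + tensor (op1 H) v v)) g + tensor X u v g) wE /tensor.
by have := young g (g v); lra.
Qed.

Section extension.
Variable f : ('B(H) -> R^o) -> R.
Hypotheses (fL : linear_on D f) (f_ge0 : forall v, D v -> Wcone v -> 0 <= f v)
  (fW : forall w, W w -> f w.1 = w.2).

Let F X u v := f (tensor X u v).

Let FG p u v : G p -> F p.1 u v = rdot (p.2 u) v.
Proof. by move=> Gp; exact: fW (W_tensor u v Gp). Qed.

Let D0 : D 0. Proof. exact: dominatedW Wcone0 WZ _ W0. Qed.
Let DD x y : D x -> D y -> D (x + y). Proof. exact: dominatedD. Qed.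
Let DZ (t : R) x : D x -> D (t *: x). Proof. exact: dominatedZ. Qed.

Let D_sum I (r : seq I) (w : I -> 'B(H) -> R^o) :
  (forall i, D (w i)) -> D (\sum_(i <- r) w i).
Proof. by move=> Dw; apply: (big_ind D). Qed.

Let f_sum I (r : seq I) (w : I -> 'B(H) -> R^o) : (forall i, D (w i)) ->
  f (\sum_(i <- r) w i) = \sum_(i <- r) f (w i).
Proof.
move=> Dw; elim: r => [|i r IH].
  by rewrite !big_nil -(scale0r 0) fL.2 ?mul0r.
by rewrite !big_cons fL.1 ?IH//; exact: D_sum.
Qed.

Let FDr X u v v' : F X u (v + v') = F X u v + F X u v'.
Proof.
rewrite /F -fL.1//; congr f; apply/funext => g.
rewrite -[RHS]/(tensor _ _ _ g + tensor _ _ _ g) /tensor linearD.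
by rewrite [LHS]rdotC rdotDl !(rdotC _ (X _)).
Qed.

Let FZr (t : R) X u v : F X u (t%:C *: v) = t * F X u v.
Proof.
rewrite /F -fL.2//; congr f; apply/funext => g.
rewrite -[RHS]/(t * tensor _ _ _ g) /tensor linearZ.
by rewrite [LHS]rdotC rdotZl (rdotC _ (X _)).
Qed.

Let F_linear (a : R[i]) X u u' v : F X (a *: u + u') v = F X u (a^* *: v) + F X u' v.
Proof.
rewrite /F -fL.1//; congr f; apply/funext => g.
rewrite -[RHS]/(tensor _ _ _ g + tensor _ _ _ g) /tensor !(linearP, linearZ).
by rewrite rdotDl rdotZ.
Qed.

Let F_linear_op (a : R[i]) X Y u v : F (a *: X + Y) u v = F X u (a^* *: v) + F Y u v.
Proof.
rewrite /F -fL.1//; congr f; apply/funext => g.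
rewrite -[RHS]/(tensor _ _ _ g + tensor _ _ _ g) /tensor linearZ opDE opZE.
by rewrite rdotDl rdotZ.
Qed.

(** The complete contractivity of the extension in linearised form: by
[form_young] the tensor evaluated below is nonnegative at every [g]. *)
Let F_young n (X : 'M['B(H)]_n) (c : R) (u v : 'I_n -> H) : 0 < c ->
  (forall w, rvec (mx_app X w) (mx_app X w) <= c ^+ 2 * rvec w w) ->
  0 <= c * (rvec u u + rvec v v) + 2 * \sum_i \sum_j F (X i j) (u j) (v i).
Proof.
move=> c0 Xc.
pose w := c *: (\sum_i (tensor (op1 H) (u i) (u i) + tensor (op1 H) (v i) (v i)))
  + 2 *: \sum_i \sum_j tensor (X i j) (u j) (v i) : 'B(H) -> R^o.
have D1 : D (\sum_i (tensor (op1 H) (u i) (u i) + tensor (op1 H) (v i) (v i))).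
  by apply: D_sum => i; exact: DD.
have D2 : D (\sum_i \sum_j tensor (X i j) (u j) (v i)).
  by apply: D_sum => i; exact: D_sum.
suff : 0 <= f w.
  rewrite /w fL.1; [|exact: DZ..]; rewrite !fL.2// !f_sum//.
  - rewrite (_ : \sum_i f _ = rvec u u + rvec v v).
      rewrite (_ : \sum_i f _ = \sum_i \sum_j F (X i j) (u j) (v i))//.
      by apply: eq_bigr => i _; rewrite f_sum.
    rewrite !rvecE -big_split; apply: eq_bigr => i _; rewrite fL.1//.
    by congr +%R; exact: (FG _ _ G1).
  - by move=> i; exact: D_sum.
  - by move=> i; exact: DD.
apply: f_ge0; first by apply: DD; exact: DZ.
move=> g.
have -> : w g = c * (rvec (g \o u) (g \o u) + rvec (g \o v) (g \o v)) +
    2 * rvec (mx_app X (g \o u)) (g \o v).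
  rewrite -[w g]/((c *: (\sum_i (tensor (op1 H) (u i) (u i) + tensor (op1 H) (v i) (v i)))) g
    + (2 *: \sum_i \sum_j tensor (X i j) (u j) (v i)) g) !fctE !fct_sumE.
  congr (_ * _ + _ * _); first by rewrite !rvecE -big_split.
  rewrite rvecE; apply: eq_bigr => i _; rewrite fct_sumE /mx_app /rdot inner_suml.
  by rewrite (big_morph (@complex.Re R) (@ReD R) (erefl 0 : complex.Re 0 = 0)).
exact: (form_young (@rvecDl R H n) (@rvecZl R H n) (@rvecC R H n) (@rvec_ge0 R H n)).
Qed.

(** The bound of [F_young] for one by one matrices, divided by [c], is the
hypothesis of the Riesz theorem. *)
Let F_rep X u : exists y, forall v, rdot y v = F X u v.
Proof.
pose c := opnorm X + 1.
have c0 : 0 < c by rewrite ltr_wpDl// opnorm_ge0.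
have bound v : 0 <= c * (rdot u u + rdot v v) + 2 * F X u v.
  have := @F_young 1 (const_mx X) c (fun=> u) (fun=> v) c0.
  by rewrite !rvecE !big_ord1 mxE; apply; exact: rvec_const_mx_le.
have [||v|y yP] := @riesz_representation R H (fun v => c^-1 * F X u v) (rdot u u).
- by move=> x y; rewrite FDr mulrDr.
- by move=> t x; rewrite FZr mulrCA.
- have := bound ((-1)%:C *: v); rewrite FZr rdotZl rdotC rdotZl => h.
  rewrite -(ler_pM2l c0) mulrCA mulVKf ?lt0r_neq0//; lra.
- exists (c%:C *: y) => v; rewrite rdotZl yP mulVKf// lt0r_neq0//.
Qed.

Lemma cp_extension : exists phi : {linear 'B(H) -> 'B(H)},
  completely_contractive phi /\ forall p, G p -> phi p.1 = p.2.
Proof.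
have [op opP] : exists op : 'B(H) -> H -> H, forall X u v, rdot (op X u) v = F X u v.
  have /choice[op opP] (Xu : 'B(H) * H) := F_rep Xu.1 Xu.2.
  by exists (fun X u => op (X, u)) => X u v; rewrite opP.
have op_bound n (X : 'M['B(H)]_n) (c : R) u : 0 < c ->
    (forall w, rvec (mx_app X w) (mx_app X w) <= c ^+ 2 * rvec w w) ->
    rvec (fun i => \sum_j op (X i j) (u j)) (fun i => \sum_j op (X i j) (u j))
      <= c ^+ 2 * rvec u u.
  move=> c0 Xc; set y := (fun i => _ : H); apply: (form_young_inv (@rvecZl R H n) (@rvecC R H n)) => // v.
  rewrite (_ : rvec y v = \sum_i \sum_j F (X i j) (u j) (v i)); first exact: F_young.
  rewrite rvecE; apply: eq_bigr => i _; rewrite /y /rdot inner_suml.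
  rewrite (big_morph (@complex.Re R) (@ReD R) (erefl 0 : complex.Re 0 = 0)).
  by apply: eq_bigr => j _; exact: opP.
have op_lin X : op X \in @bounded_linear R H.
  apply/asboolP; split=> [a u u'|].
    by apply: rdot_inj => v; rewrite opP F_linear rdotDl rdotZ !opP.
  exists (opnorm X + 1) => u.
  have := op_bound 1 (const_mx X) (opnorm X + 1) (fun=> u).
  rewrite !rvecE !big_ord1 mxE => opu.
  have c0 : 0 < opnorm X + 1 by rewrite ltr_wpDl// opnorm_ge0.
  by apply: le_norm_rdot; [exact: ltW | exact/opu/rvec_const_mx_le].
pose phi X := BoundedOp (op_lin X).
have phi_lin : linear phi.
  move=> a X Y; apply/val_inj/funext => u; apply: rdot_inj => v.
  rewrite -[val _ u]/(op _ u) opP F_linear_op.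
  by rewrite -[val _ u]/((a *: phi X + phi Y) u) opDE opZE rdotDl rdotZ !opP.
pose phiL := GRing.isLinear.Build R[i] 'B(H) 'B(H) *:%R phi phi_lin.
pose Phi : {linear 'B(H) -> 'B(H)} := HB.pack phi phiL.
exists Phi; split=> [n X|p Gp]; last first.
  apply/val_inj/funext => u; apply: rdot_inj => v.
  by rewrite -[val _ u]/(op _ u) opP; exact: FG.
apply/ler_addgt0Pr => e e0; have X0 := mx_opnorm_ge0 X.
have c0 : 0 < mx_opnorm X + e by rewrite ltr_wpDl.
apply: mx_opnorm_le => [|u]; first exact: ltW.
have -> : mx_app (map_mx Phi X) u = fun i => \sum_j op (X i j) (u j).
  by apply/funext => i; apply: eq_bigr => j _; rewrite mxE.
apply: op_bound => // w; apply: le_trans (rvec_mx_app_le X w) _.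
by rewrite ler_wpM2r ?rvec_ge0// lerXn2r ?nnegrE ?(ltW c0)// lerDl ltW.
Qed.

End extension.

(** Complete contractivity of the extension follows from [F_young] at every
constant above the norm of the matrix. *)
Theorem arveson_extension : exists phi : {linear 'B(H) -> 'B(H)},
  completely_contractive phi /\ forall p, G p -> phi p.1 = p.2.
Proof.
have [f [fL f_ge0 fW]] := krein_extension Wcone0 WconeD WconeZ W0 WD WZ W_ge0.
exact: (cp_extension fL f_ge0 fW).
Qed.

End Arveson.

(** * Operators determined by matricial order *)

Section Forward.
Variables (R : realType) (H : hilbertType R[i]) (A : set 'B(H)).
Hypothesis hA : unital_cstar_subalgebra A.
Variables (T S : 'B(H)).
Hypotheses (hT : selfadjoint T) (hS : selfadjoint S).
Hypothesis TS : forall n (h : 'M[R[i]]_n), h \is hermsymmx ->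
  forall X, mx_below A (tens_mx T h) X -> mx_ople X (tens_mx S h).

(** A relation and not a function: if [T] lies in [A], then [a + l T] has
several decompositions, and that they give the same [a + l S] is only a
consequence of the order conditions. *)
Definition affine_graph : set ('B(H) * 'B(H)) :=
  [set p | exists a l, A a /\ p = (a + l *: T, a + l *: S)].

Lemma tens_mx_adjoint (U : 'B(H)) n (B C : 'M['B(H)]_n) (h : 'M[R[i]]_n) :
  selfadjoint U -> mx_is_adjoint B C ->
  mx_is_adjoint (B + tens_mx U h) (C + tens_mx U (\matrix_(i, j) (h j i)^*)).
Proof.
move=> hU BC i j x y; rewrite !mxE !opDE !opZE innerDl innerDr BC innerZl innerZr.
by rewrite hU; congr (_ + _ * _); exact/esym/conjCK.
Qed.

(** Write [X = B + T (x) l], with adjoint [C + T (x) l^*] and [C] over [A].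
Averaging leaves the real part of the form unchanged, and the average of [B] and
[C] is a hermitian matrix over [A], to which the order condition applies. *)
Lemma affine_graph_pos n (X Y : 'M['B(H)]_n) :
  (forall i j, affine_graph (X i j, Y i j)) ->
  (forall u, 0 <= rvec (mx_app X u) u) -> forall u, 0 <= rvec (mx_app Y u) u.
Proof.
move=> XY X0 u; have [A1 AP _ Astar _] := hA.
have /choice[B BP] (ij : 'I_n * 'I_n) : exists B : 'B(H), exists C l, [/\ A B, A C,
    is_adjoint B C & (X ij.1 ij.2 = B + l *: T) /\ (Y ij.1 ij.2 = B + l *: S)].
  have [a [l [Aa [-> ->]]]] := XY ij.1 ij.2; have [b Ab ab] := Astar _ Aa.
  by exists a, b, l.
have /choice[C {}BP] := BP; have /choice[l {}BP] := BP.
pose MB := \matrix_(i, j) B (i, j); pose MC := \matrix_(i, j) C (j, i).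
pose h := \matrix_(i, j) l (i, j); pose hs := \matrix_(i, j) (h j i)^*.
have BC : mx_is_adjoint MB MC.
  by move=> i j x y; rewrite !mxE; have [_ _ + _] := BP (i, j).
have XE : X = MB + tens_mx T h.
  by apply/matrixP => i j; rewrite !mxE; have [_ _ _ []] := BP (i, j).
have YE : Y = MB + tens_mx S h.
  by apply/matrixP => i j; rewrite !mxE; have [_ _ _ []] := BP (i, j).
pose h' := (2^-1 : R)%:C *: (h + hs).
have h'P : h' \is hermsymmx.
  rewrite is_hermitianmxE expr0 scale1r; apply/eqP/matrixP => i j.
  rewrite !mxE rmorphM rmorphD; congr (_ * _); last by rewrite addrC; congr (_ + _); exact/esym/conjCK.
  by apply/esym/geC0_conj; rewrite ler0c invr_ge0.
have avgE U : mx_average (MB + tens_mx U h) (MC + tens_mx U hs) =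
    tens_mx U h' - (- mx_average MB MC).
  apply/matrixP => i j; rewrite !mxE opprK.
  by rewrite -scalerA -scalerDr scalerDl [in RHS]addrC addrACA.
have below : mx_below A (tens_mx T h') (- mx_average MB MC).
  split; first split.
  - by move=> v w; exact/mx_is_adjointE/mx_is_adjointN/mx_average_adjoint.
  - move=> i j; rewrite !mxE.
    have [AB _ _ _] := BP (i, j); have [_ AC _ _] := BP (j, i).
    have A0 : A 0 by have := AP (-1) _ _ A1 A1; rewrite scaleN1r addNr.
    rewrite -scaleNr -[_ *: _]addr0; apply: (AP _ _ _ _ A0).
    by have := AP 1 _ _ AB AC; rewrite scale1r.
  apply: mx_selfadjoint_ople; rewrite -avgE.
    by move=> v w; exact/mx_is_adjointE/mx_average_adjoint/tens_mx_adjoint.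
  by move=> v; rewrite rvec_mx_average; [rewrite -XE | exact: tens_mx_adjoint].
have /mx_opleP/(_ u)[+ _] := TS h'P below.
by rewrite -avgE rvec_mx_average; [rewrite -YE | exact: tens_mx_adjoint].
Qed.

Lemma fixed_hull_determined : fixed_hull A T -> S = T.
Proof.
move=> FT; have [A1 AP _ _ _] := hA.
have A0 : A 0 by have := AP (-1) _ _ A1 A1; rewrite scaleN1r addNr.
have [||phi [phi_cc phiG]] := @arveson_extension R H affine_graph _ _ affine_graph_pos.
- by exists (op1 H), 0; split=> //; rewrite !scale0r addr0.
- move=> a _ _ [b [l [Ab ->]]] [c [m [Ac ->]]] /=.
  exists (a *: b + c), (a * l + m); split; first exact: AP.
  by rewrite !scalerDr !scalerDl !scalerA; congr pair; rewrite addrACA.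
have <- : phi T = S.
  by apply: (phiG (T, S)); exists 0, 1; split=> //; rewrite !scale1r !add0r.
apply: FT => // a Aa; apply: (phiG (a, a)); exists a, 0; split=> //.
by rewrite !scale0r addr0.
Qed.

End Forward.

Theorem proposition4p12 (R : realType) (H : hilbertType R[i])
    (A : set 'B(H)) (hA : unital_cstar_subalgebra A)
    (T : 'B(H)) (hT : selfadjoint T) :
  fixed_hull A T <-> matricially_order_determined A T.
Proof.
split=> [FT S hS TS|]; last by have [A1 _ _ _ _] := hA; exact: determined_fixed.
by apply: (fixed_hull_determined hA hT hS) FT => n h hh X; exact: (TS n h hh).1.
Qed.
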